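(* Let $\mathbb{X}$ be a Cartesian tangent category with a curve object $(C,c_1,c_0)$, and let $M$ be an object of $\mathbb{X}$. The following two functions are well defined and mutually inverse, and so establish a bijection between the set of complete vector fields on $M$ and the set of flows on $M$: the function sending a complete vector field $F$ on $M$ to its unique solution $\gamma(F):C\times M\to M$ (i.e. the solution of the system $(M,F,1_M)$); and the function sending a flow $\gamma:C\times M\to M$ to $$\iota(\gamma):=\langle !c_0,1\rangle(c_1\times 0)T(\gamma):M\to TM.$$
   Context: Composition is written in diagrammatic order: $fg$ means first $f$, then $g$. A tangent category is a category $\mathbb{X}$ with a functor $T:\mathbb{X}\to\mathbb{X}$ and natural transformations $p:T\to 1$, $0:1\to T$, $+:T_2\to T$, $\ell:T\to T^2$, $c:T^2\to T^2$ such that: (1) for all $M,n$ the fibre power $T_nM$ of $n$ copies of $p_M:TM\to M$ exists and is preserved by every $T^k$; (2) $(p_M,+_M,0_M)$ is an additive bundle, i.e. a commutative monoid in $\mathbb{X}/M$; (3) $(\ell_M,0_M)$ is an additive bundle morphism (commuting square preserving addition and zero) from $(p_M,+_M,0_M)$ to $(T(p_M),T(+_M),T(0_M))$, and $(c_M,1_{TM})$ is one from $(T(p_M),T(+_M),T(0_M))$ to $(p_{TM},+_{TM},0_{TM})$; (4) $cc=1$, $\ell c=\ell$, $\ell T(\ell)=\ell\ell_T$, $T(c)c_TT(c)=c_TT(c)c_T$, $\ell_TT(c)c_T=cT(\ell)$; (5) with $v:=\langle\pi_0\ell,\pi_10_{TM}\rangle T(+):T_2M\to T^2M$, the square $vT(p)=\pi_0p0$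 exhibits $T_2M$ as the pullback of $T(p_M)$ along $0_M$, and this pullback is preserved by every $T^k$. It is Cartesian if it has finite products (terminal object $1$, unique maps to it written $!$) and $T$ preserves them; $T(A\times B)$ is identified with $TA\times TB$. Object subscripts are often omitted. A vector field on $M$ is a map $V:M\to TM$ with $Vp=1_M$. A dynamical system $(M,V,g)$ is a vector field $V$ on $M$ with a map $g:1\to M$. Given a fixed dynamical system $(C,c_1,c_0)$: a parameterized dynamical system (or system) $(M,V,g)$ is a vector field $V:M\to TM$ with a map $g:X\to M$; a solution of it is a map $\gamma:C\times X\to M$ with $\langle !c_0,1\rangle\gamma=g$ and $(c_1\times 0)T(\gamma)=\gamma V$. A curve object is a dynamical system $(C,c_1,c_0)$ such that: (Preinitial) every parameterized dynamical system has at most one solution; (Commutativity of $c_1$) $c_1T(c_1)c=c_1T(c_1)$; (Completeness of $c_1$) the system $(C,c_1,1_C)$ has a solution, denoted $\sigma:C\times C\to C$; $(C,\sigma,c_0)$ is then a commutative monoid. A vector field $V$ on $M$ is complete if every system $(M,V,g)$ has a solution (equivalently, $(M,V,1_M)$ has a solution); ''the solution of $V$'' means the solution of $(M,V,1_M)$. A flow on $M$ is a map $\gamma:C\times M\to M$ that is an action of $(C,\sigma,c_0)$ on $M$: $\langle !c_0,1_M\rangle\gamma=1_M$ and $(\sigma\times 1)\gamma=(1\times\gamma)\gamma$. *)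

(* Defs.v *)
From mathcomp Require Import all_boot.

Set Implicit Arguments.
Unset Strict Implicit.
Unset Printing Implicit Defensive.

Declare Scope cat_scope.
Delimit Scope cat_scope with cat.
Local Open Scope cat_scope.

(* Composition is diagrammatic throughout: [f ;; g] is first [f], then [g].

   Universal properties whose mediating map is used as an operation
   ([is_fibre_power], [is_terminal], [is_product]) carry that map as a field;
   it is determined by the accompanying uniqueness clause. *)

Record category := Category {
  obj :> Type;
  hom : obj -> obj -> Type;
  idm : forall A, hom A A;
  hcomp : forall A B C, hom A B -> hom B C -> hom A C;
  hcomp1m : forall A B (f : hom A B), hcomp (idm A) f = f;
  hcompm1 : forall A B (f : hom A B), hcomp f (idm B) = f;
  hcompA : forall A B C D (f : hom A B) (g : hom B C) (h : hom C D),
    hcomp f (hcomp g h) = hcomp (hcomp f g) h }.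

Arguments hom {c} A B.
Arguments idm {c} A.
Arguments hcomp {c A B C} f g.
Arguments hcomp1m {c A B} f.
Arguments hcompm1 {c A B} f.
Arguments hcompA {c A B C D} f g h.

Notation "f ;; g" := (hcomp f g)
  (at level 50, left associativity, format "f  ;;  g") : cat_scope.

Record functor (X Y : category) := Functor {
  fobj :> X -> Y;
  fmap : forall A B, hom A B -> hom (fobj A) (fobj B);
  fmap1 : forall A, fmap (idm A) = idm (fobj A);
  fmapM : forall A B C (f : hom A B) (g : hom B C),
    fmap (f ;; g) = fmap f ;; fmap g }.

Arguments fmap {X Y} f {A B} _ : rename.
Arguments fmap1 {X Y} f A : rename.
Arguments fmapM {X Y} f {A B C} _ _ : rename.

Definition functor_id (X : category) : functor X X :=
  @Functor X X (fun A => A) (fun A B f => f)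
    (fun A => erefl) (fun A B C f g => erefl).

Lemma functor_comp1 (X Y Z : category) (F : functor X Y) (G : functor Y Z) A :
  fmap G (fmap F (idm A)) = idm (G (F A)).
Proof. by rewrite !fmap1. Qed.

Lemma functor_compM (X Y Z : category) (F : functor X Y) (G : functor Y Z)
    A B C (f : hom A B) (g : hom B C) :
  fmap G (fmap F (f ;; g)) = fmap G (fmap F f) ;; fmap G (fmap F g).
Proof. by rewrite !fmapM. Qed.

Definition functor_comp (X Y Z : category) (F : functor X Y) (G : functor Y Z) :
    functor X Z :=
  @Functor X Z (fun A => G (F A)) (fun A B f => fmap G (fmap F f))
    (functor_comp1 F G) (functor_compM F G).

Fixpoint functor_iter (X : category) (T : functor X X) (k : nat) : functor X X :=
  if k is k'.+1 then functor_comp (functor_iter T k') T else functor_id X.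

Record nat_trans (X Y : category) (F G : functor X Y) := NatTrans {
  ncomp :> forall A, hom (F A) (G A);
  natural : forall A B (f : hom A B), ncomp A ;; fmap G f = fmap F f ;; ncomp B }.

(* Fibre powers: [P], with projections [pr i] and structure map [b], is the
   product of [n] copies of [q : E -> B] in the slice category over [B].
   For n = 0 this says that [b] is an isomorphism. *)

Record is_fibre_power (X : category) (E B : X) (q : hom E B) (n : nat) (P : X)
    (pr : 'I_n -> hom P E) (b : hom P B) : Type := IsFibrePower {
  fp_comm : forall i, pr i ;; q = b;
  fp_tuple : forall (Y : X) (f : 'I_n -> hom Y E) (g : hom Y B),
    (forall i, f i ;; q = g) -> hom Y P;
  fp_tupleE : forall (Y : X) (f : 'I_n -> hom Y E) (g : hom Y B)
    (e : forall i, f i ;; q = g) i, fp_tuple e ;; pr i = f i;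
  fp_tupleB : forall (Y : X) (f : 'I_n -> hom Y E) (g : hom Y B)
    (e : forall i, f i ;; q = g), fp_tuple e ;; b = g;
  fp_uniq : forall (Y : X) (h h' : hom Y P),
    (forall i, h ;; pr i = h' ;; pr i) -> h ;; b = h' ;; b -> h = h' }.

Record is_pullback (X : category) (A B C P : X) (f : hom A C) (g : hom B C)
    (p1 : hom P A) (p2 : hom P B) : Prop := IsPullback {
  pb_comm : p1 ;; f = p2 ;; g;
  pb_univ : forall (Y : X) (a : hom Y A) (b : hom Y B), a ;; f = b ;; g ->
    exists! h : hom Y P, h ;; p1 = a /\ h ;; p2 = b }.

Definition fam2 (A : Type) (a b : A) : 'I_2 -> A :=
  fun i => if val i is 0 then a else b.

Lemma fam2_compat (X : category) (E B Y : X) (q : hom E B) (a b : hom Y E) :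
  a ;; q = b ;; q -> forall i, fam2 a b i ;; q = a ;; q.
Proof. by move=> e [[|m] ltm]. Qed.

Definition fp_pair (X : category) (E B P Y : X) (q : hom E B)
    (pr : 'I_2 -> hom P E) (b : hom P B) (S : is_fibre_power q pr b)
    (f g : hom Y E) (e : f ;; q = g ;; q) : hom Y P :=
  fp_tuple S (fam2_compat e).

Lemma fp_proj_eq (X : category) (E B P : X) (q : hom E B) n
    (pr : 'I_n -> hom P E) (b : hom P B) (S : is_fibre_power q pr b) i j :
  pr i ;; q = pr j ;; q.
Proof. by rewrite !(fp_comm S). Qed.

(* The operations of an additive bundle, as maps over the base; the monoid laws
   are in [is_additive_bundle]. *)
Record bundle (X : category) (E B : X) := Bundle {
  bproj : hom E B;
  bpow : nat -> X;
  bpi : forall n, 'I_n -> hom (bpow n) E;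
  bbase : forall n, hom (bpow n) B;
  bpowP : forall n, is_fibre_power bproj (@bpi n) (bbase n);
  badd : hom (bpow 2) E;
  bzero : hom B E;
  badd_proj : badd ;; bproj = bbase 2;
  bzero_proj : bzero ;; bproj = idm B }.

Arguments bpi {X E B} b n i.
Arguments bpowP {X E B} b n.

Section AdditiveBundle.
Variables (X : category) (E B : X) (b : bundle E B).

(* <f, g> + *)
Definition bsum (Y : X) (f g : hom Y E)
    (e : f ;; bproj b = g ;; bproj b) : hom Y E :=
  fp_pair (bpowP b 2) e ;; badd b.

Lemma bsum_proj (Y : X) (f g : hom Y E) (e : f ;; bproj b = g ;; bproj b) :
  bsum e ;; bproj b = f ;; bproj b.
Proof. by rewrite -hcompA badd_proj fp_tupleB. Qed.

Definition bpi2_0 := bpi b 2 ord0.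
Definition bpi2_1 := bpi b 2 ord_max.
Definition bpi3_0 := bpi b 3 ord0.
Definition bpi3_1 := bpi b 3 (@Ordinal 3 1 isT).
Definition bpi3_2 := bpi b 3 ord_max.

Lemma bpi2_01 : bpi2_0 ;; bproj b = bpi2_1 ;; bproj b.
Proof. exact: fp_proj_eq (bpowP b 2) _ _. Qed.

Lemma bpi3_01 : bpi3_0 ;; bproj b = bpi3_1 ;; bproj b.
Proof. exact: fp_proj_eq (bpowP b 3) _ _. Qed.

Lemma bpi3_12 : bpi3_1 ;; bproj b = bpi3_2 ;; bproj b.
Proof. exact: fp_proj_eq (bpowP b 3) _ _. Qed.

Lemma bassocl : bsum bpi3_01 ;; bproj b = bpi3_2 ;; bproj b.
Proof. by rewrite bsum_proj bpi3_01 bpi3_12. Qed.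

Lemma bassocr : bpi3_0 ;; bproj b = bsum bpi3_12 ;; bproj b.
Proof. by rewrite bsum_proj bpi3_01. Qed.

Lemma bunitr : idm E ;; bproj b = (bproj b ;; bzero b) ;; bproj b.
Proof. by rewrite -hcompA bzero_proj hcomp1m hcompm1. Qed.

Record is_additive_bundle : Prop := IsAdditiveBundle {
  baddA : bsum bassocl = bsum bassocr;
  baddC : bsum (esym bpi2_01) = badd b;
  baddr0 : bsum bunitr = idm E;
  badd0r : bsum (esym bunitr) = idm E }.

End AdditiveBundle.

Arguments bpi2_0 {X E B} b.
Arguments bpi2_1 {X E B} b.
Arguments bpi2_01 {X E B} b.
Arguments bsum {X E B} b {Y f g} e.

Section AdditiveMorphism.
Variables (X : category) (E B E' B' : X) (b : bundle E B) (b' : bundle E' B').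
Variables (f : hom E E') (g : hom B B').

Lemma bmor_compat : f ;; bproj b' = bproj b ;; g ->
  (bpi2_0 b ;; f) ;; bproj b' = (bpi2_1 b ;; f) ;; bproj b'.
Proof. by move=> sq; rewrite -!hcompA sq !hcompA bpi2_01. Qed.

Record is_additive_bundle_morphism : Prop := IsAdditiveBundleMorphism {
  bmor_square : f ;; bproj b' = bproj b ;; g;
  bmor_add : badd b ;; f = bsum b' (bmor_compat bmor_square);
  bmor_zero : bzero b ;; f = g ;; bzero b' }.

End AdditiveMorphism.

(* The clause k = 0 of [tpowP] is the existence of the fibre powers T_n M, the
   other clauses are their preservation by T^k. *)
Record tangent_base (X : category) := TangentBase {
  tfun :> functor X X;
  tp : nat_trans tfun (functor_id X);
  tpow : nat -> X -> X;
  tpi : forall n M, 'I_n -> hom (tpow n M) (tfun M);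
  tbase : forall n M, hom (tpow n M) M;
  tpowP : forall k n M,
    is_fibre_power (fmap (functor_iter tfun k) (tp M))
      (fun i => fmap (functor_iter tfun k) (@tpi n M i))
      (fmap (functor_iter tfun k) (tbase n M)) }.

Arguments tp {X} t.
Arguments tpow {X} t n M.
Arguments tpi {X} t n M i.
Arguments tbase {X} t n M.
Arguments tpowP {X} t k n M.

Section TangentPowers.
Variables (X : category) (T : tangent_base X).

Lemma tpow_map_compat n (M N : X) (f : hom M N) (i : 'I_n) :
  (tpi T n M i ;; fmap T f) ;; tp T N = tbase T n M ;; f.
Proof.
by rewrite -hcompA -(natural (tp T) f) hcompA (fp_comm (tpowP T 0 n M) i).
Qed.

Definition tpow_map n (M N : X) (f : hom M N) : hom (tpow T n M) (tpow T n N) :=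
  fp_tuple (tpowP T 0 n N) (tpow_map_compat f).

Lemma tpow_mapE n (M N : X) (f : hom M N) (i : 'I_n) :
  tpow_map n f ;; tpi T n N i = tpi T n M i ;; fmap T f.
Proof. exact: (fp_tupleE (tpowP T 0 n N)). Qed.

Lemma tpow_mapB n (M N : X) (f : hom M N) :
  tpow_map n f ;; tbase T n N = tbase T n M ;; f.
Proof. exact: (fp_tupleB (tpowP T 0 n N)). Qed.

Lemma tpow_map1 n (M : X) : tpow_map n (idm M) = idm (tpow T n M).
Proof.
apply: (fp_uniq (tpowP T 0 n M)) => /= [i|].
  by rewrite tpow_mapE fmap1 hcomp1m hcompm1.
by rewrite tpow_mapB hcomp1m hcompm1.
Qed.

Lemma tpow_mapM n (M N P : X) (f : hom M N) (g : hom N P) :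
  tpow_map n (f ;; g) = tpow_map n f ;; tpow_map n g.
Proof.
apply: (fp_uniq (tpowP T 0 n P)) => /= [i|].
  by rewrite -hcompA !tpow_mapE hcompA tpow_mapE fmapM hcompA.
by rewrite -hcompA !tpow_mapB !hcompA tpow_mapB.
Qed.

Definition tpow_functor n : functor X X :=
  @Functor X X (tpow T n) (@tpow_map n) (@tpow_map1 n) (@tpow_mapM n).

End TangentPowers.

Record tangent_ops (X : category) := TangentOps {
  tb :> tangent_base X;
  tzero : nat_trans (functor_id X) tb;
  tplus : nat_trans (tpow_functor tb 2) tb;
  tlift : nat_trans tb (functor_comp tb tb);
  tflip : nat_trans (functor_comp tb tb) (functor_comp tb tb);
  tzero_p : forall M, tzero M ;; tp tb M = idm M;
  tplus_p : forall M, tplus M ;; tp tb M = tbase tb 2 M }.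

Arguments tzero {X} t.
Arguments tplus {X} t.
Arguments tlift {X} t.
Arguments tflip {X} t.
Arguments tzero_p {X} t M.
Arguments tplus_p {X} t M.

Section TangentBundles.
Variables (X : category) (T : tangent_ops X).

(* (p_M, +_M, 0_M) *)
Definition tbundle (M : X) : bundle (T M) M :=
  @Bundle X (T M) M (tp T M) (fun n => tpow T n M) (fun n => tpi T n M)
    (fun n => tbase T n M) (fun n => tpowP T 0 n M)
    (tplus T M) (tzero T M) (tplus_p T M) (tzero_p T M).

Lemma Ttplus_p (M : X) :
  fmap T (tplus T M) ;; fmap T (tp T M) = fmap T (tbase T 2 M).
Proof. by rewrite -fmapM tplus_p. Qed.

Lemma Ttzero_p (M : X) :
  fmap T (tzero T M) ;; fmap T (tp T M) = idm (T M).
Proof. by rewrite -fmapM tzero_p fmap1. Qed.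

(* (T(p_M), T(+_M), T(0_M)) *)
Definition Ttbundle (M : X) : bundle (T (T M)) (T M) :=
  @Bundle X (T (T M)) (T M) (fmap T (tp T M)) (fun n => T (tpow T n M))
    (fun n i => fmap T (tpi T n M i)) (fun n => fmap T (tbase T n M))
    (fun n => tpowP T 1 n M)
    (fmap T (tplus T M)) (fmap T (tzero T M)) (Ttplus_p M) (Ttzero_p M).

Lemma vlift_compat (M : X) :
  is_additive_bundle_morphism (tbundle M) (Ttbundle M) (tlift T M) (tzero T M) ->
  (bpi2_0 (tbundle M) ;; tlift T M) ;; fmap T (tp T M) =
  (bpi2_1 (tbundle M) ;; tzero T (T M)) ;; fmap T (tp T M).
Proof.
move=> [sq _ _]; rewrite -!hcompA (natural (tzero T) (tp T M)) /=.
by rewrite [tlift T M ;; _]sq !hcompA (bpi2_01 (tbundle M)).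
Qed.

(* v = <pi_0 l, pi_1 0> T(+), the pairing being into T(T_2 M) as the pullback of
   two copies of T(p_M) *)
Definition vlift (M : X)
    (H : is_additive_bundle_morphism
           (tbundle M) (Ttbundle M) (tlift T M) (tzero T M)) :
    hom (tpow T 2 M) (T (T M)) :=
  bsum (Ttbundle M) (vlift_compat H).

Record is_tangent : Prop := IsTangent {
  tang_additive : forall M, is_additive_bundle (tbundle M);
  tang_lift : forall M, is_additive_bundle_morphism
    (tbundle M) (Ttbundle M) (tlift T M) (tzero T M);
  tang_flip : forall M, is_additive_bundle_morphism
    (Ttbundle M) (tbundle (T M)) (tflip T M) (idm (T M));
  tang_flipK : forall M, tflip T M ;; tflip T M = idm (T (T M));
  tang_lift_flip : forall M, tlift T M ;; tflip T M = tlift T M;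
  tang_lift_lift : forall M,
    tlift T M ;; fmap T (tlift T M) = tlift T M ;; tlift T (T M);
  tang_flip_flip : forall M,
    fmap T (tflip T M) ;; tflip T (T M) ;; fmap T (tflip T M) =
    tflip T (T M) ;; fmap T (tflip T M) ;; tflip T (T M);
  tang_lift_flip_flip : forall M,
    tlift T (T M) ;; fmap T (tflip T M) ;; tflip T (T M) =
    tflip T M ;; fmap T (tlift T M);
  tang_universal : forall k M,
    is_pullback
      (fmap (functor_iter T k) (fmap T (tp T M)))
      (fmap (functor_iter T k) (tzero T M))
      (fmap (functor_iter T k) (vlift (tang_lift M)))
      (fmap (functor_iter T k) (bpi2_0 (tbundle M) ;; tp T M)) }.

End TangentBundles.

Record tangent_category := TangentCategory {
  tcat :> category;
  tops : tangent_ops tcat;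
  tlaws : is_tangent tops }.

Record is_terminal (X : category) (A : X) : Type := IsTerminal {
  tm_bang : forall Y : X, hom Y A;
  tm_uniq : forall (Y : X) (f g : hom Y A), f = g }.

Record is_product (X : category) (A B P : X) (p1 : hom P A) (p2 : hom P B) :
    Type := IsProduct {
  pr_pair : forall Y : X, hom Y A -> hom Y B -> hom Y P;
  pr_pair1 : forall (Y : X) (f : hom Y A) (g : hom Y B), pr_pair f g ;; p1 = f;
  pr_pair2 : forall (Y : X) (f : hom Y A) (g : hom Y B), pr_pair f g ;; p2 = g;
  pr_uniq : forall (Y : X) (h h' : hom Y P),
    h ;; p1 = h' ;; p1 -> h ;; p2 = h' ;; p2 -> h = h' }.

Record cartesian_tangent_category := CartesianTangentCategory {
  ctcat :> tangent_category;
  term_obj : ctcat;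
  term_objP : is_terminal term_obj;
  prd : ctcat -> ctcat -> ctcat;
  fst_ : forall A B, hom (prd A B) A;
  snd_ : forall A B, hom (prd A B) B;
  prdP : forall A B, is_product (fst_ A B) (snd_ A B);
  T_term_objP : is_terminal (tops ctcat term_obj);
  T_prdP : forall A B,
    is_product (fmap (tops ctcat) (fst_ A B)) (fmap (tops ctcat) (snd_ A B)) }.

Arguments term_obj {c}.
Arguments prd {c} A B.
Arguments fst_ {c} A B.
Arguments snd_ {c} A B.

Notation "A ×× B" := (prd A B) (at level 40, left associativity) : cat_scope.

Section Cartesian.
Variable X : cartesian_tangent_category.
Implicit Types A B C D M Y : X.

Definition T_ : functor X X := tops X.
Definition p_ M : hom (T_ M) M := tp (tops X) M.
Definition zero_ M : hom M (T_ M) := tzero (tops X) M.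
Definition flip_ M : hom (T_ (T_ M)) (T_ (T_ M)) := tflip (tops X) M.

Definition bang Y : hom Y term_obj := tm_bang (term_objP X) Y.

Definition prd_pair Y A B (f : hom Y A) (g : hom Y B) : hom Y (A ×× B) :=
  pr_pair (prdP A B) f g.

Definition times A B C D (f : hom A C) (g : hom B D) :
    hom (A ×× B) (C ×× D) :=
  prd_pair (fst_ A B ;; f) (snd_ A B ;; g).

Definition assoc A B C : hom ((A ×× B) ×× C) (A ×× (B ×× C)) :=
  prd_pair (fst_ (A ×× B) C ;; fst_ A B)
       (prd_pair (fst_ (A ×× B) C ;; snd_ A B) (snd_ (A ×× B) C)).

(* The identification of TA x TB with T(A x B): the inverse of <T(pi_0), T(pi_1)>. *)
Definition T_prd A B : hom (T_ A ×× T_ B) (T_ (A ×× B)) :=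
  pr_pair (T_prdP A B) (fst_ (T_ A) (T_ B)) (snd_ (T_ A) (T_ B)).

Record vector_field M := VectorField {
  vf :> hom M (T_ M);
  vf_p : vf ;; p_ M = idm M }.

Record dynamical_system := DynamicalSystem {
  dyn_obj :> X;
  dyn_vf : vector_field dyn_obj;
  dyn_pt : hom term_obj dyn_obj }.

Section Solutions.
Variable D : dynamical_system.

(* <! c_0, 1> : Y -> C x Y *)
Definition at_start Y : hom Y (D ×× Y) := prd_pair (bang Y ;; dyn_pt D) (idm Y).

(* (c_1 x 0) T(f) *)
Definition time_deriv Y M (f : hom (D ×× Y) M) : hom (D ×× Y) (T_ M) :=
  times (dyn_vf D) (zero_ Y) ;; T_prd D Y ;; fmap T_ f.

Definition is_solution M (V : vector_field M) Y (g : hom Y M)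
    (f : hom (D ×× Y) M) : Prop :=
  at_start Y ;; f = g /\ time_deriv f = f ;; V.

Definition complete M (V : vector_field M) : Prop :=
  forall Y (g : hom Y M), exists f : hom (D ×× Y) M, is_solution V g f.

Definition preinitial : Prop :=
  forall M (V : vector_field M) Y (g : hom Y M) (f f' : hom (D ×× Y) M),
    is_solution V g f -> is_solution V g f' -> f = f'.

End Solutions.

(* Completeness of c_1 is recorded through the solution [sigma] itself, which is
   unique by [co_preinitial]. *)
Record curve_object := CurveObject {
  co_sys :> dynamical_system;
  co_preinitial : preinitial co_sys;
  co_comm : dyn_vf co_sys ;; fmap T_ (dyn_vf co_sys) ;; flip_ co_sys =
            dyn_vf co_sys ;; fmap T_ (dyn_vf co_sys);
  sigma : hom (co_sys ×× co_sys) co_sys;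
  sigmaP : is_solution (dyn_vf co_sys) (idm co_sys) sigma }.

Section Flows.
Variable C : curve_object.

Record complete_vector_field M := CompleteVectorField {
  cvf :> vector_field M;
  cvf_complete : complete C cvf }.

Record flow M := Flow {
  flow_map :> hom (C ×× M) M;
  flow_start : at_start C M ;; flow_map = idm M;
  flow_sigma : times (sigma C) (idm M) ;; flow_map =
               assoc C C M ;; times (idm C) flow_map ;; flow_map }.

(* iota(gamma) = <! c_0, 1> (c_1 x 0) T(gamma) *)
Definition generator M (f : hom (C ×× M) M) : hom M (T_ M) :=
  at_start C M ;; time_deriv f.

End Flows.
End Cartesian.

Arguments T_ {X}.

(* Main.v *)
Require Import Defs.
From mathcomp Require Import all_boot.
From Stdlib Require Import IndefiniteDescription ProofIrrelevance.

(** Let [time_field Y = c_1 × 0] be the vector field on [C × Y] pointing along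
    [C], with [TC × TY] identified with [T(C × Y)]; then [time_deriv f] is
    [time_field Y ;; T f].  Everything rests on the translation
    [tau = <(1 × π_0)σ, π_1π_1> : C × (C × Y) -> C × Y] ([translate]), which adds
    the two times: it is the identity at the initial time ([at_start_translate]) and it
    maps [time_field] to itself ([time_field_translate]), both because [σ] solves
    the system [(C, c_1, 1)].  Up to associativity a flow is a map [f] with
    [at_start ;; f = 1] and [tau f = (1 × f) f] ([flow_sigmaE]).

    If [f] solves [(M, F, 1)], then [tau f] and [(1 × f) f] both solve [(M, F, f)],
    so they agree by preinitiality, and [f] is a flow ([solution_flow]).
    Conversely, if [f] is a flow, taking the time derivative of
    [tau f = (1 × f) f] at the initial time gives [time_deriv f] on the left and
    [f ;; generator f] on the right, so [f] solves [(M, generator f, 1)]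
    ([flow_solution]).  Reparametrizing such an [f] by [1 × g] solves every system
    [(M, generator f, g)], whence completeness.  Finally the equation of a solution
    [f] of [(M, F, 1)], read at the initial time, says that its generator
    is [F] ([generator_solution]), and uniqueness of solutions gives the other
    cancellation. *)

Set Implicit Arguments.
Unset Strict Implicit.
Unset Printing Implicit Defensive.

Local Open Scope cat_scope.

Section Products.
Variable X : cartesian_tangent_category.
Implicit Types A B D E Y Z : X.

Lemma pair_fst Y A B (f : hom Y A) (g : hom Y B) :
  prd_pair f g ;; fst_ A B = f.
Proof. exact: pr_pair1. Qed.

Lemma pair_snd Y A B (f : hom Y A) (g : hom Y B) :
  prd_pair f g ;; snd_ A B = g.
Proof. exact: pr_pair2. Qed.

Lemma prd_ext Y A B (f g : hom Y (A ×× B)) :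
  f ;; fst_ A B = g ;; fst_ A B -> f ;; snd_ A B = g ;; snd_ A B -> f = g.
Proof. exact: (pr_uniq (prdP A B)). Qed.

Lemma times_fst A B D E (f : hom A D) (g : hom B E) :
  times f g ;; fst_ D E = fst_ A B ;; f.
Proof. exact: pair_fst. Qed.

Lemma times_snd A B D E (f : hom A D) (g : hom B E) :
  times f g ;; snd_ D E = snd_ A B ;; g.
Proof. exact: pair_snd. Qed.

Lemma T_prd_ext Y A B (f g : hom Y (T_ (A ×× B))) :
  f ;; fmap T_ (fst_ A B) = g ;; fmap T_ (fst_ A B) ->
  f ;; fmap T_ (snd_ A B) = g ;; fmap T_ (snd_ A B) -> f = g.
Proof. exact: (pr_uniq (T_prdP A B)). Qed.

Lemma T_prd_fst A B :
  T_prd A B ;; fmap T_ (fst_ A B) = fst_ (T_ A) (T_ B).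
Proof. exact: (pr_pair1 (T_prdP A B)). Qed.

Lemma T_prd_snd A B :
  T_prd A B ;; fmap T_ (snd_ A B) = snd_ (T_ A) (T_ B).
Proof. exact: (pr_pair2 (T_prdP A B)). Qed.

Lemma zero_natural A B (f : hom A B) : zero_ A ;; fmap T_ f = f ;; zero_ B.
Proof. exact: (natural (tzero (tops X)) f). Qed.

Lemma p_natural A B (f : hom A B) : p_ A ;; f = fmap T_ f ;; p_ B.
Proof. exact: (natural (tp (tops X)) f). Qed.

Lemma zero_p A : zero_ A ;; p_ A = idm A.
Proof. exact: tzero_p. Qed.

(** The inverse of [assoc]; only one of the two composites is needed. *)
Definition unassoc A B D : hom (A ×× (B ×× D)) ((A ×× B) ×× D) :=
  prd_pair (times (idm A) (fst_ B D)) (snd_ A (B ×× D) ;; snd_ B D).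

Lemma unassocK A B D : unassoc A B D ;; assoc A B D = idm _.
Proof.
apply: prd_ext; rewrite -hcompA.
  by rewrite pair_fst hcompA pair_fst times_fst hcompm1 hcomp1m.
rewrite pair_snd hcomp1m; apply: prd_ext; rewrite -hcompA.
  by rewrite pair_fst hcompA pair_fst times_snd.
by rewrite !pair_snd.
Qed.

End Products.

Section TimeField.
Variables (X : cartesian_tangent_category) (D : dynamical_system X).
Implicit Types M N Y Z : X.

(** The vector field [c_1 × 0] on [D × Y], with [c_1] that of [D].  It is locked, since otherwise
    rewriting with associativity would split it into its two factors. *)
Definition time_field Y : hom (D ×× Y) (T_ (D ×× Y)) :=
  locked (times (dyn_vf D) (zero_ Y) ;; T_prd D Y).

Lemma time_derivE Y M (f : hom (D ×× Y) M) :
  time_deriv f = time_field Y ;; fmap T_ f.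
Proof. by rewrite /time_field -lock. Qed.

Lemma time_field_fst Y :
  time_field Y ;; fmap T_ (fst_ D Y) = fst_ D Y ;; dyn_vf D.
Proof. by rewrite /time_field -lock -hcompA T_prd_fst times_fst. Qed.

Lemma time_field_snd Y :
  time_field Y ;; fmap T_ (snd_ D Y) = snd_ D Y ;; zero_ Y.
Proof. by rewrite /time_field -lock -hcompA T_prd_snd times_snd. Qed.

Lemma time_field_p Y : time_field Y ;; p_ (D ×× Y) = idm _.
Proof.
apply: prd_ext; rewrite -hcompA p_natural hcompA hcomp1m.
  by rewrite time_field_fst -hcompA vf_p hcompm1.
by rewrite time_field_snd -hcompA zero_p hcompm1.
Qed.

Lemma time_field_reparam Y Z (h : hom Y Z) :
  time_field Y ;; fmap T_ (times (idm D) h) = times (idm D) h ;; time_field Z.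
Proof.
apply: T_prd_ext; rewrite -!hcompA -fmapM.
  by rewrite times_fst !hcompm1 !time_field_fst hcompA times_fst hcompm1.
rewrite times_snd time_field_snd hcompA times_snd fmapM hcompA time_field_snd.
by rewrite -!hcompA zero_natural.
Qed.

Lemma at_start_reparam Y Z (h : hom Y Z) :
  at_start D Y ;; times (idm D) h = h ;; at_start D Z.
Proof.
apply: prd_ext; rewrite -!hcompA ?times_fst ?times_snd hcompA.
  rewrite !pair_fst hcompm1 hcompA; congr (_ ;; _).
  exact: (tm_uniq (term_objP X)).
by rewrite !pair_snd hcomp1m hcompm1.
Qed.

Lemma time_deriv_reparam Y Z M (h : hom Y Z) (f : hom (D ×× Z) M) :
  time_deriv (times (idm D) h ;; f) = times (idm D) h ;; time_deriv f.
Proof. by rewrite !time_derivE fmapM hcompA time_field_reparam -hcompA. Qed.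

Lemma is_solution_reparam M (V : vector_field M) Y Z (h : hom Y Z) (g : hom Z M)
    (f : hom (D ×× Z) M) :
  is_solution V g f -> is_solution V (h ;; g) (times (idm D) h ;; f).
Proof.
case=> f0 f1; split; first by rewrite hcompA at_start_reparam -hcompA f0.
by rewrite time_deriv_reparam f1 hcompA.
Qed.

Lemma complete_of_solution_id M (V : vector_field M) (f : hom (D ×× M) M) :
  is_solution V (idm M) f -> complete D V.
Proof.
move=> sol Y g; exists (times (idm D) g ;; f).
by rewrite -[g in is_solution _ g _]hcompm1; apply: is_solution_reparam.
Qed.

Lemma generator_solution M (V : vector_field M) (f : hom (D ×× M) M) :
  is_solution V (idm M) f -> at_start D M ;; time_deriv f = V.
Proof. by case=> f0 ->; rewrite hcompA f0 hcomp1m. Qed.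

End TimeField.

Section CurveObject.
Variables (X : cartesian_tangent_category) (C : curve_object X).
Implicit Types M Y : X.

(** The map [C × (C × Y) -> C × Y] that adds the two times; it is
    [σ × 1] up to associativity. *)
Definition translate Y : hom (C ×× (C ×× Y)) (C ×× Y) :=
  prd_pair (times (idm C) (fst_ C Y) ;; sigma C)
           (snd_ C (C ×× Y) ;; snd_ C Y).

Lemma assoc_translate Y :
  assoc C C Y ;; translate Y = times (sigma C) (idm Y).
Proof.
have times_assoc :
    assoc C C Y ;; times (idm C) (fst_ C Y) = fst_ (C ×× C) Y.
  apply: prd_ext; rewrite -hcompA.
    by rewrite times_fst hcompm1 pair_fst.
  by rewrite times_snd hcompA pair_snd pair_fst.
apply: prd_ext; rewrite -hcompA.
  by rewrite times_fst pair_fst hcompA times_assoc.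
by rewrite times_snd pair_snd hcompA !pair_snd hcompm1.
Qed.

Lemma at_start_translate Y : at_start C (C ×× Y) ;; translate Y = idm _.
Proof.
have [sigma0 _] := sigmaP C.
apply: prd_ext; rewrite -hcompA hcomp1m.
  by rewrite pair_fst hcompA at_start_reparam -hcompA sigma0 hcompm1.
by rewrite pair_snd hcompA pair_snd hcomp1m.
Qed.

Lemma time_field_translate Y :
  time_field C (C ×× Y) ;; fmap T_ (translate Y) =
  translate Y ;; time_field C Y.
Proof.
have [_ sigma1] := sigmaP C.
apply: T_prd_ext; rewrite -!hcompA -fmapM.
  rewrite time_field_fst hcompA !pair_fst -time_derivE time_deriv_reparam.
  by rewrite sigma1 hcompA.
rewrite time_field_snd hcompA !pair_snd fmapM hcompA time_field_snd.
by rewrite -!hcompA zero_natural.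
Qed.

Lemma time_deriv_translate Y M (f : hom (C ×× Y) M) :
  time_deriv (translate Y ;; f) = translate Y ;; time_deriv f.
Proof. by rewrite !time_derivE fmapM hcompA time_field_translate -hcompA. Qed.

(** The action law of a flow, with the associativity isomorphism moved into
    [translate], so that both sides are maps out of [C × (C × M)] and can be
    compared as solutions of a system parameterized by [C × M]. *)
Lemma flow_sigmaE M (f : hom (C ×× M) M) :
  times (sigma C) (idm M) ;; f = assoc C C M ;; times (idm C) f ;; f <->
  translate M ;; f = times (idm C) f ;; f.
Proof.
rewrite -assoc_translate -!hcompA; split=> [e|->] //.
by rewrite -[LHS]hcomp1m -[RHS]hcomp1m -unassocK -!hcompA e.
Qed.

Lemma solution_flow M (V : vector_field M) (f : hom (C ×× M) M) :
  is_solution V (idm M) f ->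
  times (sigma C) (idm M) ;; f = assoc C C M ;; times (idm C) f ;; f.
Proof.
move=> sol; apply/flow_sigmaE.
apply: (@co_preinitial X C M V (C ×× M) f).
  have [_ f1] := sol; split; first by rewrite hcompA at_start_translate hcomp1m.
  by rewrite time_deriv_translate f1 hcompA.
by rewrite -[X in is_solution _ X _]hcompm1; apply: is_solution_reparam.
Qed.

Lemma generator_p M (f : flow C M) : generator f ;; p_ M = idm M.
Proof.
rewrite /generator time_derivE -!hcompA -p_natural (hcompA (time_field _ _)).
by rewrite time_field_p hcomp1m flow_start.
Qed.

(** The generator of a flow, as a vector field. *)
Definition generator_field M (f : flow C M) : vector_field M :=
  VectorField (generator_p f).

Lemma flow_solution M (f : flow C M) :
  is_solution (generator_field f) (idm M) f.
Proof.
split; first exact: flow_start.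
have /flow_sigmaE e := flow_sigma f.
(* Differentiate the action law in the first time, then set that time to c_0. *)
rewrite -[LHS]hcomp1m -at_start_translate -hcompA -time_deriv_translate e.
by rewrite time_deriv_reparam hcompA at_start_reparam -hcompA.
Qed.

End CurveObject.

(* The equations carried by these records live in types of maps on which no
   decidability is assumed, hence the use of proof irrelevance. *)
Section Extensionality.
Variables (X : cartesian_tangent_category) (C : curve_object X) (M : X).

Lemma complete_vector_field_ext (F G : complete_vector_field C M) :
  (F : hom M (T_ M)) = G -> F = G.
Proof.
case: F G => [[F Fp] Fc] [[G Gp] Gc] /= e; case: G / e Gp Gc => Gp.
rewrite (proof_irrelevance _ Gp Fp) => Gc.
by rewrite (proof_irrelevance _ Gc Fc).
Qed.

Lemma flow_ext (f g : flow C M) : (f : hom (C ×× M) M) = g -> f = g.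
Proof.
case: f g => [f f0 f1] [g g0 g1] /= e; case: g / e g0 g1 => g0 g1.
by rewrite (proof_irrelevance _ g0 f0) (proof_irrelevance _ g1 f1).
Qed.

End Extensionality.

Theorem theorem4p24 (X : cartesian_tangent_category) (C : curve_object X) (M : X) :
  exists (gamma : complete_vector_field C M -> flow C M)
         (iota : flow C M -> complete_vector_field C M),
    [/\ forall F : complete_vector_field C M,
          unique (is_solution F (idm M)) (gamma F : hom (prd C M) M),
        forall f : flow C M, (iota f : hom M (T_ M)) = generator f,
        cancel gamma iota
      & cancel iota gamma].
Proof.
(* Completeness only asserts that a solution exists, so one has to be chosen. *)
pose sol (F : complete_vector_field C M) :=
  constructive_indefinite_description _ (cvf_complete F (idm M)).
pose gamma F :=
  Flow (proj1 (proj2_sig (sol F))) (solution_flow (proj2_sig (sol F))).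
pose iota (f : flow C M) :=
  CompleteVectorField (complete_of_solution_id (flow_solution f)).
have gammaP (F : complete_vector_field C M):
    is_solution F (idm M) (gamma F) := proj2_sig (sol F).
exists gamma, iota; split=> //.
- by move=> F; split=> // f; apply: co_preinitial.
- by move=> F; apply: complete_vector_field_ext; apply: generator_solution.
- move=> f; apply: flow_ext.
  exact: (co_preinitial (gammaP (iota f)) (flow_solution f)).
Qed.
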